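(* Let $G$ be an infinite, connected, simple, undirected graph with all degrees finite. Fix a rotor mechanism on $G$ and an initial rotor configuration on $G$. Then either the rotor walk (with this mechanism and initial configuration) is recurrent for every starting vertex, or it is transient for every starting vertex.
   Context: A rotor mechanism on $G$ assigns to each vertex a fixed cyclic order of its neighbours (a single cycle through all neighbours). A rotor configuration assigns to each vertex one of its neighbours (the vertex its rotor points to). Given a rotor mechanism, an initial rotor configuration and a starting vertex for a particle, the rotor walk evolves in discrete time: at each step the rotor at the particle's current location is first incremented to point to the next neighbour in the cyclic order, and then the particle moves to this new neighbour. On such a graph, the rotor walk either visits every vertex infinitely many times (the walk is called recurrent) or visits every vertex only finitely many times (the walk is called transient). *)

(* Defs.v *)
From mathcomp Require Import all_boot.
From mathcomp Require Import classical_sets cardinality.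

Set Implicit Arguments.
Unset Strict Implicit.
Unset Printing Implicit Defensive.

Local Open Scope classical_set_scope.

Record sgraph := SGraph {
  vertex :> eqType;
  adj : rel vertex;
  adj_sym : symmetric adj;
  adj_irr : irreflexive adj
}.

Definition graph_connected (G : sgraph) : Prop :=
  forall u v : G, exists2 p : seq G, path (@adj G) u p & last u p = v.

Definition locally_finite (G : sgraph) : Prop :=
  forall v : G, finite_set [set w : G | adj v w].

(* The cyclic order at v is presented by listing the neighbours of v once      *)
(* each, starting anywhere; the neighbour after w is next (rotor_cycle v) w,   *)
(* which depends only on the list up to rotation.                              *)
Record rotor_mechanism (G : sgraph) := RotorMechanism {
  rotor_cycle :> G -> seq G;
  rotor_cycle_uniq : forall v : G, uniq (rotor_cycle v);
  mem_rotor_cycle : forall v w : G, (w \in rotor_cycle v) = adj v w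
}.

Record rotor_config (G : sgraph) := RotorConfig {
  rotor :> G -> G;
  rotor_adj : forall v : G, adj v (rotor v)
}.

Section RotorWalk.
Variables (G : sgraph) (m : rotor_mechanism G).

(* A state consists of the current rotors and the location of the particle.    *)
Definition rotor_step (s : (G -> G) * G) : (G -> G) * G :=
  let: (rho, x) := s in
  let y := next (m x) (rho x) in
  (fun v => if v == x then y else rho v, y).

Definition rotor_walk (rho : rotor_config G) (o : G) (n : nat) : G :=
  (iter n rotor_step (rotor rho, o)).2.

Definition visits (rho : rotor_config G) (o v : G) : set nat :=
  [set n | rotor_walk rho o n = v].

Definition recurrent (rho : rotor_config G) (o : G) : Prop :=
  forall v : G, infinite_set (visits rho o v).

Definition transient (rho : rotor_config G) (o : G) : Prop :=
  forall v : G, finite_set (visits rho o v).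

End RotorWalk.

(* Main.v *)
Require Import Defs.
From mathcomp Require Import all_boot.
From mathcomp Require Import boolp classical_sets cardinality.

(* The emission counts (odometer) of a walk from o that is back at o are       *)
(* balanced: every vertex has emitted exactly as many particles as it has      *)
(* received.  By the least action principle, any walk started at a with the    *)
(* same initial rotors stays below such a balanced odometer u as long as a     *)
(* itself has emitted at most u(a) times; as u has finite mass, the walk must  *)
(* eventually emit more than u(a) times from a.  If the walk from o is         *)
(* recurrent then u(a) is unbounded over the returns to o, so the walk from a  *)
(* returns to a infinitely often.                                              *)

Local Open Scope classical_set_scope.

(** Both halves of the argument rest on the conservation law [inflow_odometer]. It makes infinitely
    many visits spread across an edge ([infinite_visits_adj]), hence to all vertices by
    connectedness. It also balances the odometer at each return and gives the least action principle
    [odometer_le_balanced], by which recurrence passes from one start to any other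
    ([recurrent_start]). So a single vertex visited infinitely often from a single start makes every
    start recurrent. *)

Lemma iter_next_connect (T : eqType) (p : seq T) (x y : T) :
  uniq p -> x \in p -> y \in p -> exists i, iter i (next p) x = y.
Proof.
move=> Up xp yp; have [i p' Ep] := rot_to xp.
have Uq : uniq (x :: p') by rewrite -Ep rot_uniq.
have := cycle_next Uq; rewrite /= rcons_path => /andP[/fpathE Ep' _].
have: y \in x :: p' by rewrite -Ep mem_rot.
rewrite Ep' -trajectS => /trajectP[j _ ->]; exists j.
by apply: eq_iter => z; rewrite -Ep next_rot.
Qed.

Lemma count_mem_traject_next_unbounded (T : eqType) (p : seq T) (x y : T) :
  uniq p -> x \in p -> y \in p ->
  forall k, exists n, k <= count_mem y (traject (next p) x n).
Proof.
move=> Up xp yp; elim=> [|k [n lekn]]; first by exists 0.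
have xnp : iter n (next p) x \in p by elim: (n) => //= j; rewrite mem_next.
have [i Ei] := iter_next_connect _ _ _ _ Up xnp yp.
exists (n + i.+1); rewrite trajectD count_cat trajectSr Ei.
by rewrite -cats1 count_cat /= eqxx -addn1 leq_add // addn0 leq_addl.
Qed.

Section Odometer.
Variables (G : sgraph) (m : rotor_mechanism G) (rho : rotor_config G).

Definition odometer (o : G) (t : nat) (x : G) : nat :=
  count_mem x (mkseq (rotor_walk m rho o) t).

(** What [y] sends to [x] depends only on how often [y] has emitted, not on when. The trajectory
    starts one step past [rho y] because the rotor turns before the particle moves. *)
Definition sent (y x : G) (k : nat) : nat :=
  count_mem x (traject (next (m y)) (next (m y) (rho y)) k).

Definition inflow (u : G -> nat) (x : G) : nat :=
  \sum_(y <- m x) sent y x (u y).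

Lemma odometerS (o : G) (t : nat) (x : G) :
  odometer o t.+1 x = odometer o t x + (rotor_walk m rho o t == x).
Proof. by rewrite /odometer mkseqS -cats1 count_cat /= addn0. Qed.

Lemma leq_odometer (o x : G) (s t : nat) :
  s <= t -> odometer o s x <= odometer o t x.
Proof.
move=> /subnK <-; elim: (t - s) => //= n IHn.
by rewrite addSn odometerS (leq_trans IHn) ?leq_addr.
Qed.

Lemma sentS (y x : G) (k : nat) :
  sent y x k.+1 = sent y x k + (iter k.+1 (next (m y)) (rho y) == x).
Proof. by rewrite /sent trajectSr -cats1 count_cat /= addn0 -iterSr. Qed.

Lemma leq_sent (y x : G) (k l : nat) : k <= l -> sent y x k <= sent y x l.
Proof.
move=> /subnK <-; elim: (l - k) => //= n IHn.
by rewrite addSn sentS (leq_trans IHn) ?leq_addr.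
Qed.

Lemma leq_inflow (u v : G -> nat) (x : G) :
  (forall y, u y <= v y) -> inflow u x <= inflow v x.
Proof. by move=> le_uv; apply: leq_sum => y _; apply: leq_sent. Qed.

Lemma rotor_iter_step (o : G) (t : nat) (y : G) :
  (iter t (rotor_step m) (rotor rho, o)).1 y
    = iter (odometer o t y) (next (m y)) (rho y).
Proof.
elim: t => [//|t IHt]; rewrite odometerS /rotor_walk.
rewrite iterS; case: (iter t _ _) IHt => r x /= IHt.
by rewrite eq_sym; case: eqVneq IHt => [<-|_] ->; rewrite ?addn1 ?addn0.
Qed.

Lemma rotor_walkS (o : G) (t : nat) :
  let x := rotor_walk m rho o t in
  rotor_walk m rho o t.+1 = iter (odometer o t x).+1 (next (m x)) (rho x).
Proof.
rewrite /= -rotor_iter_step /rotor_walk iterS.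
by case: (iter t _ _).
Qed.

Lemma adj_rotor_walk (o : G) (t : nat) :
  adj (rotor_walk m rho o t) (rotor_walk m rho o t.+1).
Proof.
rewrite rotor_walkS -(mem_rotor_cycle m); set x := rotor_walk _ _ _ _.
by elim: (_.+1) => [|n IHn] /=; rewrite ?mem_next // mem_rotor_cycle rotor_adj.
Qed.

(** Conservation of particles. The boundary terms are the particle placed at [o] at time 0 and the
    one now waiting, whose emission is counted only at the next step. *)
Lemma inflow_odometer (o : G) (t : nat) (x : G) :
  inflow (odometer o t) x + (o == x)
    = odometer o t x + (rotor_walk m rho o t == x).
Proof.
elim: t => [|t IHt]; first by rewrite /inflow big1.
rewrite odometerS -IHt addnAC; congr (_ + _).
set w := rotor_walk m rho o t; set w' := rotor_walk m rho o t.+1.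
have step y : sent y x (odometer o t.+1 y)
    = sent y x (odometer o t y) + (if y == w then (w' == x : nat) else 0).
  rewrite odometerS -/w eq_sym; case: eqVneq => [->|_]; last by rewrite !addn0.
  by rewrite addn1 sentS -rotor_walkS.
rewrite /inflow (eq_bigr _ (fun y _ => step y)) big_split /=; congr (_ + _).
have [w'x|_] := eqVneq w' x; last by rewrite big1 // => y _; case: ifP.
(* [inflow] sums over the neighbours of [x] only; symmetry of [adj] puts the emitter [w] among
   them. *)
have wx : w \in m x by rewrite mem_rotor_cycle adj_sym -w'x adj_rotor_walk.
rewrite (bigD1_seq w) ?rotor_cycle_uniq //= eqxx big1 ?addn0 //.
by move=> y /negPf->.
Qed.

(** When the particle stands at [x] other than [a], its next emission brings the count at [x]
    exactly up to what [x] has received, which is at most [inflow u x]. *)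
Lemma odometer_le_balanced (a : G) (u : G -> nat) (s : nat) :
    (forall x, inflow u x <= u x) ->
  odometer a s a <= u a -> forall x, odometer a s x <= u x.
Proof.
move=> bal; elim: s => [//|s IHs] le_a x.
have {}IHs := IHs (leq_trans (leq_odometer a a _ _ (leqnSn s)) le_a).
have [->//|xa] := eqVneq x a.
rewrite odometerS; case: eqVneq => [wx|_]; last by rewrite addn0.
have := inflow_odometer a s x; rewrite wx eqxx eq_sym (negPf xa) addn0 => <-.
exact: leq_trans (leq_inflow _ _ _ IHs) (bal x).
Qed.

Lemma odometer_exceeds_return (o a : G) (t : nat) :
  rotor_walk m rho o t = o -> exists s, odometer o t a < odometer a s a.
Proof.
move=> ret; exists t.+1; rewrite ltnNge; apply/negP => le_a.
have bal x : inflow (odometer o t) x <= odometer o t x.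
  by have /eqP := inflow_odometer o t x; rewrite ret eqn_add2r => /eqP ->.
(* Pointwise domination would make a list of length [t.+1] a permutation of a subsequence of one of
   length [t]. *)
have /count_subseqP[r /size_subseq + /perm_size Er] :=
  odometer_le_balanced _ _ _ bal le_a.
by rewrite -Er !size_mkseq ltnn.
Qed.

Lemma infinite_visits_later (o x : G) (t : nat) :
  infinite_set (visits m rho o x) ->
  exists2 s, t <= s & rotor_walk m rho o s = x.
Proof.
move=> inf_x; apply: contrapT => no_visit; apply: inf_x.
apply: (sub_finite_set _ (finite_seq (iota 0 t))) => s xs /=.
rewrite mem_iota /= add0n ltnNge; apply/negP => le_ts.
by apply: no_visit; exists s.
Qed.

Lemma infinite_visitsP (o x : G) :
  infinite_set (visits m rho o x) <-> forall k, exists t, k <= odometer o t x.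
Proof.
split=> [inf_x|unb].
  elim=> [|k [t le_k]]; first by exists 0.
  have [s le_ts xs] := infinite_visits_later _ _ t inf_x.
  exists s.+1; rewrite odometerS xs eqxx addn1 ltnS.
  exact: leq_trans le_k (leq_odometer _ _ _ _ le_ts).
case/finite_seqP => r Er; have [t] := unb (size r).+1.
rewrite /odometer count_map -size_filter ltnNge => /negP; apply.
apply: uniq_leq_size; first by rewrite filter_uniq ?iota_uniq.
move=> s; rewrite mem_filter => /andP[/eqP xs _].
have: visits m rho o x s by [].
by rewrite Er.
Qed.

Lemma infinite_visits_adj (o v w : G) : adj v w ->
  infinite_set (visits m rho o v) -> infinite_set (visits m rho o w).
Proof.
move=> vw /infinite_visitsP inf_v; apply/infinite_visitsP => k.
(* The extra unit pays for a particle that [w] may have received but not yet emitted. *)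
have [n le_n] : exists n, k.+1 <= sent v w n.
  apply: count_mem_traject_next_unbounded.
  - exact: rotor_cycle_uniq.
  - by rewrite mem_next mem_rotor_cycle rotor_adj.
  - by rewrite mem_rotor_cycle.
have [t le_t] := inf_v n; exists t.
have vmw : v \in m w by rewrite mem_rotor_cycle adj_sym.
have le_in : k.+1 <= inflow (odometer o t) w.
  rewrite /inflow (bigD1_seq v) ?rotor_cycle_uniq //=.
  by rewrite (leq_trans le_n) // (leq_trans (leq_sent _ _ _ _ le_t)) ?leq_addr.
rewrite -ltnS (leq_trans le_in) // -addn1.
rewrite (leq_trans (leq_addr (o == w) _)) // inflow_odometer leq_add2l.
exact: leq_b1.
Qed.

Lemma infinite_visits_recurrent (o v : G) : graph_connected G ->
  infinite_set (visits m rho o v) -> recurrent m rho o.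
Proof.
move=> connG inf_v w; have [p] := connG v w.
elim: p v inf_v => [|z p IHp] v inf_v /=; first by move=> _ <-.
by move=> /andP[vz]; apply: IHp; apply: infinite_visits_adj inf_v.
Qed.

Lemma recurrent_start (o a : G) : graph_connected G ->
  recurrent m rho o -> recurrent m rho a.
Proof.
move=> connG rec_o; apply: (infinite_visits_recurrent a a connG).
apply/infinite_visitsP => k.
have [t le_k] := (infinite_visitsP o a).1 (rec_o a) k.
(* Waiting for a return to [o] balances the odometer and does not lower the count at [a]. *)
have [s le_ts ret] := infinite_visits_later _ _ t (rec_o o).
have [r lt_r] := odometer_exceeds_return o a s ret.
exists r; apply: leq_trans le_k (leq_trans _ (ltnW lt_r)).
exact: leq_odometer.
Qed.

End Odometer.

Theorem theorem1 (G : sgraph) (infG : infinite_set [set: G])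
    (connG : graph_connected G) (lfG : locally_finite G)
    (m : rotor_mechanism G) (rho : rotor_config G) :
  (forall o : G, recurrent m rho o) \/ (forall o : G, transient m rho o).
Proof.
have [[o [v inf_v]]|no_inf] :=
  EM (exists o v, infinite_set (visits m rho o v)).
  left=> a; apply: (recurrent_start _ _ _ o) => //.
  exact: infinite_visits_recurrent inf_v.
right=> o v; apply: contrapT => inf_v.
by apply: no_inf; exists o, v.
Qed.
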